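(* Let $F$ be an infinite field of characteristic different from $2$, let $G$ be a group, and let $A=M_n(F)$ be the matrix algebra with an elementary grading induced by an $n$-tuple of pairwise distinct elements of $G$. The algebra $A$ has the primeness property for graded central polynomials if and only if the grading is a crossed product grading and the group $G$ has no non-trivial homomorphism $G\rightarrow F^{\times}$.
   Context: A grading by a group $G$ on an $F$-algebra $A$ is a vector space decomposition $A=\oplus_{g\in G}A_g$ with $A_gA_h\subseteq A_{gh}$ for all $g,h\in G$. Let $E_{ij}$ be the elementary matrix with $1$ in the $(i,j)$-th entry and $0$ elsewhere. The elementary grading on $M_n(F)$ induced by an $n$-tuple $(g_1,\dots,g_n)$ of elements of $G$ is the one where $A_g$ is spanned by the matrices $E_{ij}$ with $g_i^{-1}g_j=g$. An elementary grading induced by an $n$-tuple of pairwise distinct elements of a group $G$ is called a crossed product grading if the group $G$ has order $n$. $F\langle X_G\rangle$ is the free associative algebra on the variables $x_{i,g}$ ($i\in\mathbb{N}$, $g\in G$), where $x_{i,g}$ has degree $g$. For $f(x_{1,g_1},\dots,x_{m,g_m})\in F\langle X_G\rangle$, an admissible substitution is a tuple $(a_1,\dots,a_m)$ with $a_i\in A_{g_i}$. The polynomial $f$ is a graded polynomial identity for $A$ if $f(a_1,\dots,a_m)=0$ for every admissible substitution; $f$ is a graded central polynomial for $A$ if it is not a graded polynomial identity and $f(a_1,\dots,a_m)\in Z(A)$ (the centre of $A$) for every admissible substitution. $A$ has the primeness property for graded central polynomials if, whenever the product $f\cdot g$ of two polynomials $f,g\in F\langle X_G\rangle$ in distinct variables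 (no variable occurs in both) is a graded central polynomial for $A$, both $f$ and $g$ are graded central polynomials for $A$.
   Formalization: It is additionally assumed that the support of the grading generates G; without this the claim fails, e.g. for n = 1 and G non-trivial, where A = F has the primeness property but G does not have order 1. A crossed product grading satisfies this automatically. *)

(* Defs.v *)
From HB Require Import structures.
From mathcomp Require Import all_boot all_order all_algebra all_field.
From mathcomp Require Import boolp classical_sets cardinality.
From mathcomp Require Import finmap monalg.

Set Implicit Arguments.
Unset Strict Implicit.
Unset Printing Implicit Defensive.

Import GRing.Theory.
Local Open Scope ring_scope.

(* F<X_G>, the unital free associative algebra: (i, g) stands for x_{i,g}. *)
Notation gvar G := (nat * G)%type.
Notation gpoly F G := {malg F[{fmonom gvar G}]}.

Section GradedPolynomials.
Context (F : fieldType) (G : groupType) (A : falgType F).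
Implicit Types (Agr : G -> {vspace A}) (f g : gpoly F G) (a : gvar G -> A).

Definition eval a f : A :=
  mmap (in_alg A) (fun m : {fmonom gvar G} => \prod_(x <- m) a x) f.

Definition occurs (x : gvar G) f : bool :=
  has (fun m : {fmonom gvar G} => x \in (m : seq (gvar G))) (msupp f).

Definition distinct_variables f g : Prop := forall x, ~~ (occurs x f && occurs x g).

(* All variables are assigned a value, not only those of a given f: since
   0 is in every Agr h, any admissible tuple for f extends to such an a. *)
Definition admissible Agr a : Prop := forall x, a x \in Agr x.2.

Definition graded_identity Agr f : Prop :=
  forall a, admissible Agr a -> eval a f = 0.

Definition graded_central Agr f : Prop :=
  ~ graded_identity Agr f /\
  forall a, admissible Agr a -> eval a f \in 'Z({:A})%VS.

Definition primeness_property Agr : Prop :=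
  forall f g, distinct_variables f g -> graded_central Agr (f * g) ->
    graded_central Agr f /\ graded_central Agr g.

(* The usual normalisation that G has no elements irrelevant to the grading.
   It is automatic for a crossed product grading. Without it the primeness
   property cannot force G to be finite: M_1(F) has that property for every G,
   and enlarging G beyond the support of a grading never affects it. *)
Definition support_generates Agr : Prop :=
  forall S : {pred G}, group_closed S ->
    (forall h, Agr h != 0%VS -> h \in S) -> forall h, h \in S.

End GradedPolynomials.

Section ElementaryGrading.
Context (F : fieldType) (G : groupType) (n : nat) (t : 'I_n.+1 -> G).

Definition elementary_basis (h : G) : seq 'M[F]_n.+1 :=
  [seq delta_mx p.1 p.2 |
    p <- enum {: 'I_n.+1 * 'I_n.+1} & (((t p.1)^-1 * t p.2)%g == h)].

Definition elementary_grading (h : G) : {vspace 'M[F]_n.+1} :=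
  <<elementary_basis h>>%VS.

Definition crossed_product : Prop :=
  injective t /\ ([set: G] #= `I_n.+1)%card.

End ElementaryGrading.

(* A group homomorphism from G to F^*, as a nowhere zero map to F. *)
Definition hom_to_units (F : fieldType) (G : groupType) (chi : G -> F) : Prop :=
  (forall g, chi g != 0) /\ {morph chi : g h / (g * h)%g >-> g * h}.

Definition has_nontrivial_hom (F : fieldType) (G : groupType) : Prop :=
  exists2 chi : G -> F, hom_to_units chi & exists g, chi g != 1.

(* Main.v *)
(* If [f * g] is central and [f], [g] share no variable, then fixing the
   variables of [g] shows that all values of [f] lie on one line [F U], with [U]
   invertible.  That line is preserved by every graded automorphism.  Conjugation
   by diagonal matrices forces [U] to be diagonal; for a crossed product,
   conjugation by left translations makes the diagonal of [U] a multiple of a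
   character of [G], so [U] is scalar when [G] has no non-trivial character.

   Conversely, let [H] be the stabilizer of the set [T] of the [t i] for left
   translation, and let [x_0 ... x_n] be the monomial of a closed path through
   all of [T].  The rotation of this monomial starting at [t k] takes diagonal
   values; its entry at [t i] is a weight that depends only on [t i / t k] and
   vanishes unless [t i / t k \in H].  Hence, if [u (h * t i) / u (t i)] depends
   only on [h \in H], the sum of the rotations with coefficients [u k] takes its
   values in [F diag u].  The product of two such polynomials for [u] and [u^-1],
   in distinct variables, is central, so primeness forces [u] to be constant.
   Taking [u = 1] on one [H]-orbit and [-1] elsewhere gives that [H] is transitive
   on [T]; since the support generates [G], this means [T = G].  Taking for [u] a
   character of [G] gives that this character is trivial. *)

Require Import Defs.
From HB Require Import structures.
From mathcomp Require Import all_boot all_order all_algebra all_field.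
From mathcomp Require Import boolp classical_sets cardinality.
From mathcomp Require Import perm finmap monalg.
Set Implicit Arguments.
Unset Strict Implicit.
Unset Printing Implicit Defensive.
Import GRing.Theory.
Local Open Scope ring_scope.

(** * Evaluation of graded polynomials *)

Lemma evalM (F : fieldType) (G : groupType) (A : falgType F)
    (a : gvar G -> A) (f g : gpoly F G) :
  eval a (f * g) = eval a f * eval a g.
Proof.
pose h (m : {fmonom gvar G}) := \prod_(x <- m) a x.
have hM : mmorphism h.
  by split=> [m1 m2|]; rewrite /h ?fmM ?big_cat // fm1 big_nil.
pose hh : {mmorphism {fmonom gvar G} -> A} :=
  HB.pack h (monalg.isMultiplicative.Build _ _ h hM).
(* Coefficients act as scalars, so they commute with all values even though [A] need not be
   commutative. *)
have cA (e : gpoly F G) (m m' : {fmonom gvar G}) :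
    GRing.comm (in_alg A e@_m) (hh m').
  by rewrite /GRing.comm /= -scalerAl -scalerAr mul1r mulr1.
by have [+ _] := commr_mmap_is_multiplicative cA; apply.
Qed.

Lemma evalU (F : fieldType) (G : groupType) (A : falgType F)
    (a : gvar G -> A) (c : F) (m : {fmonom gvar G}) :
  eval a << c *g m >> = c *: \prod_(x <- m) a x.
Proof. by rewrite /eval mmapU /= mulr_algl. Qed.

Lemma eval_sum (F : fieldType) (G : groupType) (A : falgType F)
    (a : gvar G -> A) (I : finType) (f : I -> gpoly F G) :
  eval a (\sum_i f i) = \sum_i eval a (f i).
Proof. exact: raddf_sum. Qed.

(** * Matrix units, the centre, homogeneous components *)

Section Matrices.
Context (F : fieldType) (G : groupType) (n : nat) (t : 'I_n.+1 -> G).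
Notation M := 'M[F]_n.+1.
Implicit Types (f g : gpoly F G) (a b : gvar G -> M) (P X U : M).

Lemma eval_conj P a f : P \is a GRing.unit ->
  eval (fun x => P * a x * P^-1) f = P * eval a f * P^-1.
Proof.
move=> Pu; rewrite /eval !mmapE mulr_sumr mulr_suml; apply: eq_bigr => m _.
rewrite !mulr_algl -scalerAr -scalerAl; congr (_ *: _).
apply: (big_rec2 (fun x y => x = P * y * P^-1)) => [|x y1 y2 _ ->].
  by rewrite mulr1 divrr.
by rewrite !mulrA mulrVK.
Qed.

Lemma mul_mx_deltaE X i j k l :
  (X * delta_mx i j) k l = X k i *+ (l == j).
Proof.
rewrite mxE (bigD1 i) //= big1 ?addr0 => [|m /negPf mi].
  by rewrite mxE eqxx mulr_natr.
by rewrite mxE mi mulr0.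
Qed.

Lemma mul_delta_mxE X i j k l :
  (delta_mx i j * X) k l = X j l *+ (k == i).
Proof.
rewrite mxE (bigD1 j) //= big1 ?addr0 => [|m /negPf mi].
  by rewrite mxE eqxx andbT mulr_natl.
by rewrite mxE mi andbF mul0r.
Qed.

(** Commuting with [delta_mx i 0] equates the diagonal entries; commuting with [delta_mx j j] kills
    the entries off the diagonal. *)
Lemma center_matrixP X :
  reflect (exists c : F, X = c%:M) (X \in 'Z({:M})%VS).
Proof.
apply: (iffP idP) => [|[c ->]]; last first.
  by rewrite memv_cap memvf; apply/centvP => Y _; apply: comm_scalar_mx.
rewrite memv_cap memvf => /centvP cX; exists (X 0 0).
apply/matrixP => i j; rewrite !mxE; have [<- | neq_ij] := eqVneq i j.
  have /matrixP/(_ i 0) := cX (delta_mx i 0) (memvf _).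
  by rewrite mul_mx_deltaE mul_delta_mxE !eqxx.
have /matrixP/(_ i j) := cX (delta_mx j j) (memvf _).
by rewrite mul_mx_deltaE mul_delta_mxE eqxx (negPf neq_ij).
Qed.

Lemma mem_elementary h X :
  reflect (forall i j, X i j != 0 -> (t i * h)%g = t j)
    (X \in elementary_grading F t h).
Proof.
apply: (iffP idP) => [Xh i j | Xh].
  apply: contraNeq => neq_h.
  have -> := @coord_span _ _ _ (in_tuple (elementary_basis F t h)) X Xh.
  rewrite summxE big1 // => k _.
  rewrite mxE [Y in _ * Y](_ : _ = 0) ?mulr0 //.
  have /mapP[[i' j']] : (in_tuple (elementary_basis F t h))`_k
      \in elementary_basis F t h by apply: mem_nth.
  rewrite mem_filter => /andP[/= /eqP h_ij _ ->]; rewrite mxE.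
  case: eqP => [ii'|//]; case: eqP => [jj'|//].
  by case/eqP: neq_h; rewrite -h_ij ii' jj' mulgA mulgV mul1g.
rewrite [X]matrix_sum_delta; apply: memv_suml => i _; apply: memv_suml => j _.
have [->|/Xh t_ij] := eqVneq (X i j) 0; first by rewrite scale0r mem0v.
apply/memvZ/memv_span/mapP; exists (i, j) => //.
by rewrite mem_filter mem_enum andbT -t_ij /= mulgA mulVg mul1g.
Qed.
End Matrices.

(** * Twisted sums of rotations of a closed path *)

Section ClosedPath.
Context (F : fieldType) (G : groupType) (n : nat) (t : 'I_n.+1 -> G).
Hypothesis t_inj : injective t.
Notation M := 'M[F]_n.+1.
Notation Agr := (elementary_grading F t).
Implicit Types (a : gvar G -> M) (X : M) (u : 'I_n.+1 -> F) (g h : G).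

(* The closed path [t_0, ..., t_n, t_0], as an [n.+1]-periodic sequence. *)
Definition vertex (k : nat) : G := t (inord (k %% n.+1)).

Lemma vertex_ord (k : 'I_n.+1) : vertex k = t k.
Proof. by rewrite /vertex modn_small // inord_val. Qed.

(* The row [E_g] with [E_g X] a multiple of [E_(g h)] for [X] of degree [h];
   it is [0] when [g] is not one of the [t i]. *)
Definition indicator g : 'rV[F]_n.+1 := \row_i (t i == g)%:R.

Lemma indicator_vertex i : indicator (t i) = delta_mx 0 i.
Proof. by apply/rowP => j; rewrite !mxE (inj_eq t_inj). Qed.

Lemma indicator_neq0 g : indicator g != 0 -> exists i, t i = g.
Proof.
by case/rV0Pn=> i; rewrite mxE; have [<- _|] := eqVneq (t i) g;
  [exists i | rewrite eqxx].
Qed.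

(** This is [X i j] when [g = t i] and [h = t j], and [0] when [g] or [h] is not one of the [t i]. A
    path can thus be translated by any group element. *)
Definition edge_entry X g h : F := (indicator g *m X *m (indicator h)^T) 0 0.

Lemma edge_entry_neq0 X g h : edge_entry X g h != 0 -> exists i, t i = g.
Proof.
move=> X_neq0; apply: indicator_neq0; apply: contraNneq X_neq0 => g0.
by rewrite /edge_entry g0 !mul0mx mxE.
Qed.

Lemma indicator_mul X g h : X \in Agr h ->
  indicator g *m X = edge_entry X g (g * h)%g *: indicator (g * h)%g.
Proof.
move=> /mem_elementary Xh; apply/rowP => j; rewrite !mxE.
have [t_j|neq_j] := eqVneq (t j) (g * h)%g.
  by rewrite mulr1 /edge_entry -t_j indicator_vertex trmx_delta -colE !mxE.
rewrite mulr0 big1 // => i _; rewrite mxE.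
have [t_i|] := eqVneq (t i) g; last by rewrite mul0r.
by rewrite mul1r; apply: contraNeq neq_j => /Xh <-; rewrite t_i.
Qed.

Definition step_degree (k : nat) : G := ((vertex k)^-1 * vertex k.+1)%g.
(** The offset [s] serves to give two polynomials disjoint variables. *)
Definition step_var (s k : nat) : gvar G := ((s + k)%N, step_degree k).

Definition rotated_word (s k : nat) : {fmonom gvar G} :=
  FMonom [seq step_var s l | l <- iota k (n.+1 - k) ++ iota 0 k].

Definition twisted_poly (u : 'I_n.+1 -> F) (s : nat) : gpoly F G :=
  \sum_(k < n.+1) << u k *g rotated_word s k >>.

(** The product of the entries along the path translated by [h] does not depend on the starting
    vertex, so all rotations share it. *)
Definition cycle_weight a s h : F :=
  \prod_(l < n.+1)
    edge_entry (a (step_var s l)) (h * vertex l)%g (h * vertex l.+1)%g.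

Definition stabilizes h := forall i, exists j, t j = (h * t i)%g.

Lemma cycle_weight_neq0 a s h : cycle_weight a s h != 0 -> stabilizes h.
Proof.
move=> c_neq0 i.
apply: (@edge_entry_neq0 (a (step_var s i)) _ (h * vertex i.+1)%g).
apply: contraNneq c_neq0 => ent0.
by rewrite /cycle_weight (bigD1 i) //= vertex_ord ent0 mul0r.
Qed.

(** Left translation preserves the step degrees, so a row started at [h * vertex k] follows the
    translated path. *)
Lemma indicator_path a s h k r : admissible Agr a ->
  indicator (h * vertex k)%g *m \prod_(l <- iota k r) a (step_var s l) =
  (\prod_(l <- iota k r)
     edge_entry (a (step_var s l)) (h * vertex l)%g (h * vertex l.+1)%g) *:
   indicator (h * vertex (k + r))%g.
Proof.
move=> adm; elim: r k => [|r IHr] k.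
  by rewrite !big_nil addn0 scale1r mulmx1.
rewrite /= !big_cons -mulmxE mulmxA (@indicator_mul _ _ (step_degree k)).
  by rewrite -scalemxAl /step_degree mulgA mulgK IHr scalerA addSnnS.
exact: adm.
Qed.

Lemma indicator_rotated_word a s i (k : 'I_n.+1) : admissible Agr a ->
  indicator (t i) *m \prod_(x <- rotated_word s k) a x =
  cycle_weight a s (t i * (t k)^-1)%g *: indicator (t i).
Proof.
move=> adm; set h := (t i * (t k)^-1)%g.
have hk : (h * vertex k)%g = t i by rewrite vertex_ord mulgVK.
rewrite big_map big_cat /= -mulmxE mulmxA -{1}hk indicator_path //.
rewrite subnKC 1?ltnW // -scalemxAl.
(* The path closes up: the second segment of the rotation starts where the first one ends. *)
have -> : vertex n.+1 = vertex 0 by rewrite /vertex modnn mod0n.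
rewrite indicator_path // add0n hk scalerA; congr (_ *: _).
rewrite mulrC -big_cat /= -[in X in _ ++ iota X _](add0n k) -iotaD.
by rewrite subnKC 1?ltnW // /cycle_weight -(big_mkord xpredT
  (fun l => edge_entry (a (step_var s l)) (h * vertex l)%g (h * vertex l.+1)%g))
  /index_iota subn0.
Qed.

Definition twisted_weight a s u i : F :=
  \sum_k u k * cycle_weight a s (t i * (t k)^-1)%g.

Lemma eval_twisted_poly a s u : admissible Agr a ->
  eval a (twisted_poly u s) = diag_mx (\row_i twisted_weight a s u i).
Proof.
move=> adm; apply/row_matrixP => i; rewrite row_diag_mx mxE.
rewrite rowE -indicator_vertex eval_sum mulmx_sumr.
rewrite scaler_suml; apply: eq_bigr => k _.
rewrite evalU -scalemxAr indicator_rotated_word //.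
by rewrite scalerA.
Qed.

(** Cross-multiplied form of [u i / u k = u j / u l]: translation by [h] multiplies [u] by a
    constant. *)
Definition compatible u := forall h, stabilizes h -> forall i j k l,
  (h * t k)%g = t i -> (h * t l)%g = t j -> u i * u l = u j * u k.

(** Translation by [h] is an injective self-map of the finite image of [t], hence onto. *)
Lemma stabilizes_inv h : stabilizes h -> forall j, exists l, (h * t l)%g = t j.
Proof.
move=> /choice[p tp].
have p_inj : injective p.
  by move=> k l pkl; apply/t_inj/(@mulgI _ h); rewrite -!tp pkl.
by move=> j; exists (invF p_inj j); rewrite -tp f_invF.
Qed.

(** If the weight is non-zero, [h] stabilizes the image of [t], so exactly one [l] satisfies
    [h * t l = t j]. *)
Lemma cycle_weight_sum a s h j : cycle_weight a s h =
  \sum_l cycle_weight a s h *+ (h == t j * (t l)^-1)%g.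
Proof.
have [c0|/cycle_weight_neq0/stabilizes_inv/(_ j)[l tl]] :=
  eqVneq (cycle_weight a s h) 0.
  by rewrite c0 big1 // => l _; rewrite mul0rn.
rewrite (bigD1 l) //= -{1}tl mulgK eqxx big1 ?addr0 // => k neq_kl.
case: eqP => // h_eq; case/eqP: neq_kl; apply/t_inj/(@mulgI _ h).
by rewrite tl {1}h_eq mulgVK.
Qed.

(** Both sides expand into sums over the pairs [(k, l)] with [t i / t k = t j / t l]. Compatibility,
    applied to this common quotient, equates the terms. *)
Lemma twisted_weight_sym a s u i j : compatible u ->
  twisted_weight a s u i * u j = twisted_weight a s u j * u i.
Proof.
move=> u_compat; rewrite !mulr_suml.
pose e i k := (t i * (t k)^-1)%g.
transitivity
  (\sum_k \sum_l u k * (cycle_weight a s (e i k) *+ (e i k == e j l)) * u j).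
  by apply: eq_bigr => k _; rewrite -mulr_suml -mulr_sumr -cycle_weight_sum.
rewrite exchange_big; apply: eq_bigr => l _ /=.
rewrite [in RHS](cycle_weight_sum _ _ _ i) mulr_sumr mulr_suml.
apply: eq_bigr => k _; rewrite -/(e i k) -/(e j l) eq_sym.
case: eqP => [e_eq|]; last by rewrite !mulr0 !mul0r.
rewrite !mulr1n -e_eq.
have [->|/cycle_weight_neq0 st] := eqVneq (cycle_weight a s (e j l)) 0.
  by rewrite !mulr0 !mul0r.
rewrite mulrAC [RHS]mulrAC [u k * _]mulrC [u l * _]mulrC.
congr (_ * _); apply/esym/(u_compat _ st); last by rewrite mulgVK.
by rewrite e_eq mulgVK.
Qed.

Lemma eval_twisted_poly_scale a s u : admissible Agr a -> compatible u ->
  (forall i, u i != 0) ->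
  exists c : F, eval a (twisted_poly u s) = c *: diag_mx (\row_i u i).
Proof.
move=> adm u_compat u_neq0; exists (twisted_weight a s u 0 / u 0).
rewrite eval_twisted_poly // -linearZ; congr diag_mx; apply/rowP => i.
by rewrite !mxE mulrAC (twisted_weight_sym a s 0 i u_compat) mulfK.
Qed.

(* On this substitution only the untranslated path has a non-zero weight, for
   the variables of [twisted_poly u s] with any [s] divisible by [n.+1]. *)
Definition cycle_point (x : gvar G) : M :=
  let k := (x.1 %% n.+1)%N in
  delta_mx (inord k) (inord (k.+1 %% n.+1)) *+ (x.2 == step_degree k).

Lemma admissible_cycle_point : admissible Agr cycle_point.
Proof.
move=> [m h]; apply/mem_elementary => i j; rewrite /cycle_point /=.
have [->|_] := eqVneq h; last by rewrite mulr0n mxE eqxx.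
rewrite mulr1n mxE; have [->|] := eqVneq i; last by rewrite eqxx.
have [-> _|] := eqVneq j; last by rewrite eqxx.
by rewrite /step_degree mulgA /vertex modn_mod mulgV mul1g.
Qed.

Lemma edge_entry_delta i j g h :
  edge_entry (delta_mx i j) g h = ((t i == g) && (t j == h))%:R.
Proof.
rewrite /edge_entry mxE (bigD1 j) //= big1 ?addr0 => [|k /negPf neq_kj].
  rewrite !mxE (bigD1 i) //= big1 ?addr0 => [|k /negPf neq_ki].
    by rewrite !mxE !eqxx mulr1 -natrM mulnb.
  by rewrite !mxE neq_ki mulr0.
by rewrite mxE big1 ?mul0r // => i' _; rewrite !mxE neq_kj andbF mulr0.
Qed.

Lemma cycle_weight_cycle_point r h :
  cycle_weight cycle_point (r * n.+1) h = (h == 1%g)%:R.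
Proof.
have ent (l : 'I_n.+1) : edge_entry (cycle_point (step_var (r * n.+1) l))
    (h * vertex l)%g (h * vertex l.+1)%g = (h == 1%g)%:R.
  rewrite /cycle_point /= modnMDl modn_small // eqxx edge_entry_delta.
  rewrite -/(vertex l.+1) inord_val -vertex_ord -{1}[vertex l]mul1g.
  rewrite -{1}[vertex l.+1]mul1g !(inj_eq (@mulIg _ _)) andbb.
  by rewrite eq_sym.
rewrite /cycle_weight (eq_bigr _ (fun l _ => ent l)) prodr_const card_ord.
by case: (h == 1%g); rewrite ?expr1n // expr0n.
Qed.

Lemma eval_cycle_point u r :
  eval cycle_point (twisted_poly u (r * n.+1)) = diag_mx (\row_i u i).
Proof.
rewrite eval_twisted_poly; last exact: admissible_cycle_point.
congr diag_mx; apply/rowP => i; rewrite !mxE /twisted_weight (bigD1 i) //=.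
rewrite mulgV cycle_weight_cycle_point eqxx mulr1 big1 ?addr0 // => k.
move=> neq_ki; rewrite cycle_weight_cycle_point; case: eqP => [ik|_].
  by case/eqP: neq_ki; apply: t_inj; rewrite -[RHS](mulgVK (t k)) ik mul1g.
by rewrite mulr0.
Qed.

Lemma occurs_twisted_poly x u s : occurs x (twisted_poly u s) ->
  (s <= x.1 < s + n.+1)%N.
Proof.
pose P (f : gpoly F G) := forall (m : {fmonom gvar G}) y,
  m \in msupp f -> y \in (m : seq (gvar G)) ->
  (s <= y.1 < s + n.+1)%N.
suff Ptw : P (twisted_poly u s) by case/hasP => m; apply: Ptw.
apply: (big_ind P) => [m y|f g Pf Pg m y /(fsubsetP (msuppD_le _ _))|k _ m y].
- by rewrite msupp0.
- by rewrite in_fsetU => /orP[]; [apply: Pf | apply: Pg].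
move=> /(fsubsetP msuppU_le); rewrite inE => /eqP-> /mapP[l + ->] /=.
rewrite mem_cat !mem_iota (subnKC (ltnW (ltn_ord k))) leq_addr ltn_add2l.
by rewrite add0n => /orP[] /andP[_] // /leq_trans->; rewrite // ltnW.
Qed.

Lemma not_primeness u : compatible u -> (forall i, u i != 0) ->
  (exists i j, u i != u j) -> ~ primeness_property Agr.
Proof.
move=> u_compat u_neq0 [i [j neq_u]].
pose v i := (u i)^-1.
have v_neq0 k : v k != 0 by rewrite invr_eq0.
have v_compat : compatible v.
  move=> h st k l k' l' h1 h2; rewrite /v -!invfM; congr (_^-1).
  by rewrite (u_compat h st k l k' l').
have uv : diag_mx (\row_k u k) * diag_mx (\row_k v k) = 1 :> M.
  rewrite -mulmxE mulmx_diag -[1]/(1%:M) -diag_const_mx; congr diag_mx.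
  by apply/rowP => k; rewrite !mxE mulfV.
(* Both offsets are multiples of [n.+1], so [cycle_point] serves both factors, and they differ by
   the length of the path, so no variable is shared. *)
move=> /(_ (twisted_poly u (0 * n.+1)) (twisted_poly v (1 * n.+1))).
case=> [x||[_ cent_u] _].
- apply/negP => /andP[/occurs_twisted_poly/andP[_ x_lt]].
  move=> /occurs_twisted_poly/andP[x_ge _].
  by rewrite mul0n add0n mul1n in x_lt x_ge; rewrite ltnNge x_ge in x_lt.
- split=> [/(_ _ admissible_cycle_point)|a adm].
    by rewrite evalM !eval_cycle_point uv => /eqP; rewrite oner_eq0.
  rewrite evalM.
  have [c ->] := eval_twisted_poly_scale (0 * n.+1) adm u_compat u_neq0.
  have [d ->] := eval_twisted_poly_scale (1 * n.+1) adm v_compat v_neq0.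
  by rewrite -scalerAl -scalerAr uv; apply/memvZ/memvZ/center_matrixP; exists 1.
have /center_matrixP[c] := cent_u _ admissible_cycle_point.
rewrite eval_cycle_point => /matrixP uE; case/eqP: neq_u.
by have := (uE i i, uE j j); rewrite !mxE !eqxx !mulr1n => -[-> ->].
Qed.
End ClosedPath.

(** * Polynomials with values on a line, and primeness of crossed products *)

Section CrossedProduct.
Context (F : fieldType) (G : groupType) (n : nat) (t : 'I_n.+1 -> G).
Notation M := 'M[F]_n.+1.
Notation Agr := (elementary_grading F t).
Implicit Types (f g : gpoly F G) (a b : gvar G -> M) (P U X : M).

Lemma eq_eval f a b : (forall x, occurs x f -> a x = b x) ->
  eval a f = eval b f.
Proof.
move=> ab; rewrite /eval !mmapE; apply: eq_big_seq => m mf; congr (_ * _).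
by apply: eq_big_seq => x xm; apply: ab; apply/hasP; exists m.
Qed.

Definition takes_values_in_line f U : Prop :=
  (forall a, admissible Agr a -> exists c : F, eval a f = c *: U) /\
  (exists2 a, admissible Agr a & eval a f = U).

(** Conjugating a point where [f] takes the value [U] gives an admissible point with value
    [P * U * P^-1], again on the line of [U]. *)
Lemma conj_line f U P : takes_values_in_line f U -> P \is a GRing.unit ->
  (forall h X, X \in Agr h -> P * X * P^-1 \in Agr h) ->
  exists c : F, P * U = c *: (U * P).
Proof.
move=> [lineU [a adm aU]] Pu P_adm.
have [x|c] := lineU (fun x => P * a x * P^-1); first exact: P_adm.
rewrite eval_conj // aU => fP; exists c.
by rewrite scalerAl -fP mulrVK.
Qed.

Lemma diag_conj_line f U (d : 'I_n.+1 -> F) : takes_values_in_line f U ->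
  (forall i, d i != 0) ->
  exists c : F, forall i j, d i * U i j = c * (U i j * d j).
Proof.
move=> lineU d_neq0; pose D := diag_mx (\row_i d i).
pose E := diag_mx (\row_i (d i)^-1) : M.
have DE : D * E = 1.
  rewrite -mulmxE mulmx_diag -[1]/(1%:M) -diag_const_mx; congr diag_mx.
  by apply/rowP => k; rewrite !mxE mulfV.
have ED : E * D = 1 by apply: mulmx1C.
have Du : D \is a GRing.unit by apply/unitrP; exists E.
have D_inv : D^-1 = E by rewrite -[RHS]mulr1 -(divrr Du) mulrA ED mul1r.
have [h X /mem_elementary Xh|c cU] := conj_line lineU Du.
  apply/mem_elementary => i j.
  rewrite D_inv -!mulmxE mul_mx_diag mul_diag_mx !mxE => XE.
  by apply: Xh; apply: contraNneq XE => ->; rewrite mulr0 mul0r.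
exists c => i j; have /matrixP/(_ i j) := cU.
by rewrite -!mulmxE mul_mx_diag mul_diag_mx !mxE.
Qed.

Lemma unit_row_neq0 U i : U \is a GRing.unit -> exists j, U i j != 0.
Proof.
move=> Uu; suff /rV0Pn[j] : row i U != 0 by rewrite mxE; exists j.
apply: contraTneq Uu => Ui0; apply/negP => Uu.
have /matrixP/(_ i i) := divrr Uu; rewrite -mulmxE !mxE eqxx big1 => [/eqP|k _].
  by rewrite eq_sym oner_eq0.
by have /rowP/(_ k) := Ui0; rewrite !mxE => ->; rewrite mul0r.
Qed.

Lemma line_diag f U : infinite_set [set: F]%classic ->
  takes_values_in_line f U -> U \is a GRing.unit ->
  forall i j, i != j -> U i j = 0.
Proof.
move=> F_inf lineU Uu i j neq_ij; apply/eqP; apply: contraT => Uij.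
(* Conjugation will use the diagonal matrix with [x] at [i] and [1] elsewhere; what matters is that
   [x] is non-zero and [x ^+ 2 != 1]. *)
have [x xP] : exists x : F, x \notin [:: 0; 1; -1].
  apply/not_existsP => Fx; apply: F_inf.
  apply: (@sub_finite_set _ _ [set` [:: 0; 1; -1 : F]]) => [x _|];
    last exact: finite_seq.
  by apply: contra_notT (Fx x).
move: xP; rewrite !inE !negb_or => /and3P[x0 x1 xN1].
pose d k := if k == i then x else 1.
have [|c cU] := @diag_conj_line f U d lineU.
  by move=> k; rewrite /d; case: ifP => // _; apply: oner_neq0.
have cx : c = x.
  have := cU i j; rewrite /d eqxx eq_sym (negPf neq_ij) mulr1.
  by move/(mulIf Uij).
(* A non-zero entry in row [j] yields [1 = x * d l], where [d l] is [x] or [1]: both are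
   excluded. *)
have [l Ujl] := unit_row_neq0 j Uu.
have := cU j l; rewrite cx /d eq_sym (negPf neq_ij) mul1r mulrCA.
rewrite -[LHS]mulr1 => /(mulfI Ujl)/esym/eqP; case: ifP => _.
  by rewrite -expr2 sqrf_eq1 (negPf x1) (negPf xN1).
by rewrite mulr1 (negPf x1).
Qed.

Hypothesis t_inj : injective t.
Hypothesis t_surj : forall h, exists i, t i = h.

(** Translation by [h] permutes the indices and keeps every [(t i)^-1 * t j], so its permutation
    matrix acts by a graded automorphism. *)
Lemma translation_line f U h : takes_values_in_line f U ->
  exists c : F, forall i j, t j = (h * t i)%g -> U j j = c * U i i.
Proof.
move=> lineU.
have [p tp] := choice (fun i => t_surj (h * t i)%g).
have p_inj : injective p.
  by move=> k l pkl; apply/t_inj/(@mulgI _ h); rewrite -!tp pkl.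
pose s := perm p_inj; pose P := perm_mx s : M.
have Pu : P \is a GRing.unit by exact: unitmx_perm.
have PE X : P * X * P^-1 = row_perm s (col_perm s X).
  by rewrite row_permE col_permE perm_mxV mulmxA.
have [h' X /mem_elementary Xh|c cU] := conj_line lineU Pu.
  apply/mem_elementary => k l; rewrite PE !mxE => /Xh.
  by rewrite !permE !tp -mulgA => /mulgI.
exists c => k l tl.
have : P * U * P^-1 = c *: U by rewrite cU -scalerAl mulrK.
rewrite PE => /matrixP/(_ k k); rewrite !mxE !permE.
by have -> : p k = l by apply: t_inj; rewrite tp tl.
Qed.

Lemma line_scalar f U : infinite_set [set: F]%classic ->
  ~ has_nontrivial_hom F G ->
  takes_values_in_line f U -> U \is a GRing.unit -> exists c : F, U = c%:M.
Proof.
move=> F_inf no_hom lineU Uu.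
have U_diag := line_diag F_inf lineU Uu.
have [r rK] := choice t_surj.
pose w h := U (r h) (r h).
have w_neq0 h : w h != 0.
  have [j] := unit_row_neq0 (r h) Uu.
  by have [<-|/U_diag->] := eqVneq (r h) j; rewrite ?eqxx.
(* The same constant [c] relates [w (h * k)] to [w k] and [w h] to [w 1], so [w] divided by [w 1] is
   a character. *)
have wM h k : w (h * k)%g * w 1%g = w h * w k.
  have [c cU] := translation_line h lineU.
  rewrite /w (cU (r k)) ?rK // (cU (r 1%g) (r h)) ?rK ?mulg1 //.
  by rewrite mulrAC.
have w1 h : w h = w 1%g.
  apply/eqP; apply: contra_notT no_hom => neq_w.
  exists (fun h => w h / w 1%g).
    split=> [k|k l]; first by rewrite mulf_neq0 ?invr_eq0.
    by rewrite mulrACA -wM mulrA mulfK.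
  exists h; apply: contraNneq neq_w => /(congr1 ( *%R^~ (w 1%g))).
  by rewrite mulfVK ?mul1r // => ->.
exists (w 1%g); apply/matrixP => i j; rewrite mxE.
have [<-|/U_diag->//] := eqVneq i j.
have <- : r (t i) = i by apply: t_inj; rewrite rK.
exact: w1.
Qed.

Lemma crossed_product_primeness : infinite_set [set: F]%classic ->
  ~ has_nontrivial_hom F G -> primeness_property Agr.
Proof.
move=> F_inf no_hom f g dist [/existsNP[a0 /not_implyP[adm0 fg0]] fg_cent].
(* As no variable is shared, [f] and [g] can be evaluated at independent points, glued into the
   single point [e]. *)
have value a b : admissible Agr a -> admissible Agr b ->
    exists c : F, eval a f * eval b g = c%:M.
  move=> adm_a adm_b; pose e x := if occurs x f then a x else b x.
  have -> : eval a f = eval e f by apply: eq_eval => x xf; rewrite /e xf.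
  have -> : eval b g = eval e g.
    apply: eq_eval => x xg; rewrite /e ifN //.
    by have := dist x; rewrite xg andbT.
  rewrite -evalM; apply/center_matrixP/fg_cent => x.
  by rewrite /e; case: ifP.
have [c0 UV] := value a0 a0 adm0 adm0.
have c0_neq0 : c0 != 0.
  by apply/eqP => c00; apply: fg0; rewrite evalM UV c00 raddf0.
set U := eval a0 f in UV; set V := eval a0 g in UV.
have UV1 : U * (c0^-1 *: V) = 1.
  by rewrite -scalerAr UV -mul_scalar_mx -scalar_mxM mulVf.
have VU1 : (c0^-1 *: V) * U = 1 by apply: mulmx1C.
have Uu : U \is a GRing.unit by apply/unitrP; exists (c0^-1 *: V).
have Vu : V \is a GRing.unit.
  apply/unitrP; exists (c0^-1 *: U).
  by split; [rewrite -scalerAl scalerAr | rewrite -scalerAr scalerAl].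
(* [V] is the inverse of [U] up to [c0], so a scalar value of [eval a f * V] puts [eval a f] on the
   line of [U]. *)
have lineU : takes_values_in_line f U.
  split=> [a adm|]; last by exists a0.
  have [c fV] := value a a0 adm adm0; exists (c / c0).
  rewrite -[LHS]mulr1 -VU1 mulrA -scalerAr fV -scalerAl.
  by rewrite -mulmxE mul_scalar_mx scalerA mulrC.
have lineV : takes_values_in_line g V.
  split=> [a adm|]; last by exists a0.
  have [c Ug] := value a0 a adm0 adm; exists (c / c0).
  rewrite -[LHS]mul1r -VU1 -mulrA Ug -scalerAl.
  by rewrite -mulmxE mul_mx_scalar scalerA mulrC.
suff central k W : W \is a GRing.unit -> eval a0 k = W ->
    takes_values_in_line k W -> graded_central Agr k.
  by split; [apply: (central _ U) | apply: (central _ V)].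
move=> Wu kW lineW; split=> [/(_ a0 adm0)|a adm].
  by rewrite kW => W0; rewrite W0 unitr0 in Wu.
have [c ->] := lineW.1 a adm.
have [d ->] := line_scalar F_inf no_hom lineW Wu.
by apply/center_matrixP; exists (c * d); rewrite -scale_scalar_mx.
Qed.
End CrossedProduct.

(** * Surjectivity of [t]: cardinality and transitivity of the stabilizer *)

Lemma crossed_product_surj (G : groupType) (n : nat) (t : 'I_n.+1 -> G) :
  crossed_product t -> forall h, exists i, t i = h.
Proof.
move=> [t_inj /card_set_bijP[r [r_lt r_inj _]]] h.
have r_bound k : (r k < n.+1)%N by exact: r_lt.
pose q k : 'I_n.+1 := Ordinal (r_bound k).
have q_inj : injective q by move=> k l [/r_inj]; apply; apply: mem_set.
(* An injective self-map of the finite type ['I_n.+1] is onto. *)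
have tq_inj : injective (q \o t) by apply: inj_comp.
exists (invF tq_inj (q h)); apply: q_inj.
exact: (f_invF tq_inj).
Qed.

Lemma surj_crossed_product (G : groupType) (n : nat) (t : 'I_n.+1 -> G) :
  injective t -> (forall h, exists i, t i = h) -> crossed_product t.
Proof.
move=> t_inj /choice[r rK]; split=> //; apply/card_set_bijP.
exists (fun h => nat_of_ord (r h)).
split=> [h _|h k _ _ /ord_inj hk|i /= i_lt].
- exact: ltn_ord.
- by rewrite -(rK h) hk rK.
exists (t (Ordinal i_lt)) => //=.
by rewrite [r _](_ : _ = Ordinal i_lt) //; apply: t_inj; rewrite rK.
Qed.

Section Stabilizer.
Context (G : groupType) (n : nat) (t : 'I_n.+1 -> G).
Hypothesis t_inj : injective t.
Implicit Types h k : G.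

Lemma stabilizes1 : stabilizes t 1%g.
Proof. by move=> i; exists i; rewrite mul1g. Qed.

Lemma stabilizesM h k :
  stabilizes t h -> stabilizes t k -> stabilizes t (h * k)%g.
Proof.
move=> sh sk i; have [j tj] := sk i; have [l tl] := sh j.
by exists l; rewrite tl tj mulgA.
Qed.

Lemma stabilizesV h : stabilizes t h -> stabilizes t h^-1%g.
Proof.
move=> /(stabilizes_inv t_inj) sh i; have [j <-] := sh i.
by exists j; rewrite mulKg.
Qed.
End Stabilizer.

Lemma primeness_surj (F : fieldType) (G : groupType) (n : nat)
    (t : 'I_n.+1 -> G) : 2%N \notin [pchar F] -> injective t ->
  support_generates (elementary_grading F t) ->
  primeness_property (elementary_grading F t) -> forall h, exists i, t i = h.
Proof.
move=> char2 t_inj t_gen prime_t.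
(* Only [t i / t 0] translates [t 0] to [t i], so this says that [t i] is in the orbit of [t 0]. *)
pose in_orbit i := stabilizes t (t i * (t 0)^-1)%g.
have orbitM h i k : stabilizes t h -> (h * t k)%g = t i ->
    in_orbit k -> in_orbit i.
  by move=> sh hk; rewrite /in_orbit -hk -mulgA; apply: stabilizesM.
have orbit_all i : in_orbit i.
  apply: contrapT => i_out.
  pose u k : F := if `[< in_orbit k >] then 1 else -1.
  have u_eq h i' k : stabilizes t h -> (h * t k)%g = t i' -> u i' = u k.
    move=> sh hk; rewrite /u; congr (if _ then _ else _).
    apply: asbool_equiv_eq.
    split; last exact: orbitM hk.
    by apply: (orbitM h^-1%g); [apply: stabilizesV | rewrite -hk mulKg].
  apply: (not_primeness t_inj (u := u)) prime_t.
  - by move=> h sh i1 j1 k l /(u_eq h _ _ sh)-> /(u_eq h _ _ sh)->; rewrite mulrC.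
  - by move=> k; rewrite /u; case: ifP; rewrite ?oppr_eq0 oner_eq0.
  exists 0, i; rewrite /u asboolT ?asboolF //; last first.
    by rewrite /in_orbit mulgV; apply: stabilizes1.
  rewrite -addr_eq0; apply: contra char2 => two0.
  by rewrite inE.
have all_stab h : stabilizes t h.
  (* [S] is the stabilizer conjugated by [t 0]. It contains each degree [(t i)^-1 * t j] of the
     support, which the conjugation turns into a quotient of the stabilizing elements [t i / t 0]
     and [t j / t 0]. *)
  pose S : {pred G} := fun h => `[< stabilizes t (t 0 * h * (t 0)^-1)%g >].
  have S_mem k : k \in S = `[< stabilizes t (t 0 * k * (t 0)^-1)%g >] by [].
  suff: ((t 0)^-1 * h * t 0)%g \in S.
    by rewrite S_mem => /asboolP; rewrite !mulgA mulgV mul1g mulgK.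
  apply: t_gen => [|k].
    split=> [|x y];
      first by rewrite S_mem mulg1 mulgV; apply/asboolP/stabilizes1.
    rewrite !S_mem => /asboolP sx /asboolP sy; apply/asboolP.
    have -> : (t 0 * (x / y) / t 0)%g = (t 0 * x / t 0 * (t 0 * y / t 0)^-1)%g.
      by rewrite !invgM invgK !mulgA mulgVK.
    by apply: stabilizesM => //; apply: stabilizesV.
  rewrite -vpick0 => /matrix0Pn[i [j /(mem_elementary _ _ _ (memv_pick _)) tk]].
  rewrite S_mem; apply/asboolP.
  have -> : (t 0 * k / t 0)%g = ((t i / t 0)^-1 * (t j / t 0))%g.
    by rewrite -tk invgM invgK !mulgA mulgVK.
  by apply: stabilizesM (orbit_all j); apply: (stabilizesV t_inj) (orbit_all i).
move=> h; have [j tj] := all_stab (h * (t 0)^-1)%g 0.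
by exists j; rewrite tj mulgVK.
Qed.

Theorem theorem3p10 (F : fieldType) (G : groupType) (n : nat)
    (t : 'I_n.+1 -> G)
    (F_infinite : infinite_set [set: F]%classic)
    (F_char : 2%N \notin [pchar F])
    (t_inj : injective t)
    (t_gen : support_generates (elementary_grading F t)) :
  primeness_property (elementary_grading F t) <->
  crossed_product t /\ ~ has_nontrivial_hom F G.
Proof.
split=> [prime_t|[/crossed_product_surj t_surj no_hom]]; last first.
  exact: crossed_product_primeness.
have t_surj := primeness_surj F_char t_inj t_gen prime_t.
split=> [|[chi [chi_neq0 chiM] [h chi_h]]]; first exact: surj_crossed_product.
have chi1 : chi 1%g = 1.
  by apply: (mulfI (chi_neq0 1%g)); rewrite -chiM mulg1 mulr1.
apply: (not_primeness t_inj (u := chi \o t)) prime_t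
  => [k _ i j l m /= <- <-||].
- by rewrite !chiM mulrAC.
- by move=> i; apply: chi_neq0.
have [i ti] := t_surj h; have [j tj] := t_surj 1%g.
by exists i, j; rewrite /= ti tj chi1.
Qed.
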